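(* Let $d\in\mathbb{N}$, $d\ge2$, let $G$ be a $d$-regular infinite connected graph with root $o$, and let $\lambda\in(0,d-1)$. Let $\mathbb{T}_d$ be the $d$-regular tree. (i) We have $$\rho_G(\lambda)\ \ge\ \rho_{\mathbb{T}_d}(\lambda)=\frac{2\sqrt{(d-1)\lambda}}{d-1+\lambda}.$$ (ii) Assume in addition that $G$ is (vertex-)transitive. Then $\rho_G(\lambda)=\rho_{\mathbb{T}_d}(\lambda)$ if and only if $G$ is isomorphic to $\mathbb{T}_d$.
   Context: Graphs are undirected and simple. For a locally finite, connected, infinite graph $G$ with a fixed root vertex $o$, $|x|$ denotes the graph distance from $x$ to $o$. For a vertex $v$, $d_v$ is its degree, and $d_v^-$ is the number of edges connecting $v$ to vertices at distance $|v|-1$ from $o$ (with $d_o^-=0$). For $\lambda>0$, the $\lambda$-biased random walk $\mathrm{RW}_\lambda=(X_n)_{n\ge0}$ on $(G,o)$ is the nearest-neighbour Markov chain on the vertices of $G$ with transition probabilities, for $u$ adjacent to $v$: $p_\lambda(v,u)=\frac1{d_v}$ if $v=o$; $p_\lambda(v,u)=\frac{\lambda}{d_v+(\lambda-1)d_v^-}$ if $v\ne o$ and $|u|=|v|-1$; $p_\lambda(v,u)=\frac{1}{d_v+(\lambda-1)d_v^-}$ otherwise. The spectral radius is $\rho_G(\lambda)=\limsup_{n\to\infty}p_\lambda^{(n)}(o,o)^{1/n}$, where $p_\lambda^{(n)}(o,o)=\mathbb{P}_o(X_n=o)$ for $\mathrm{RW}_\lambda$ on $G$. (Here $d-1=\lambda_c(\mathbb{T}_d)$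 is the critical value of $\lambda$ separating transience and recurrence of $\mathrm{RW}_\lambda$ on $\mathbb{T}_d$.) *)

(* Defs.v *)
From mathcomp Require Import all_boot all_order all_algebra finmap zify.
From mathcomp Require Import all_classical all_reals all_analysis.

Set Implicit Arguments.
Unset Strict Implicit.
Unset Printing Implicit Defensive.

Import Order.TTheory GRing.Theory Num.Theory.

Local Open Scope classical_set_scope.
Local Open Scope ring_scope.

(* Simple undirected graphs.  Under the classical axioms every type carries a
   choiceType structure and every relation is boolean, so neither choice
   restricts the class of graphs. *)
Record graph := Graph {
  vertex :> choiceType;
  adj : rel vertex;
  adj_sym : symmetric adj;
  adj_irrefl : irreflexive adj }.

Section Graph.
Variable G : graph.
Implicit Types (o u v w : G) (n : nat).

Definition neighbors v : set G := [set u | adj v u].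

(* fset_set is the empty finite set on infinite sets, so this is the degree
   of v only when v has finitely many neighbors *)
Definition degree v : nat := #|` fset_set (neighbors v)|%fset.

Definition locally_finite := forall v, finite_set (neighbors v).

Definition regular (d : nat) := locally_finite /\ forall v, degree v = d.

Definition walk_of_length u v n :=
  exists p : seq G, [/\ path (@adj G) u p, last u p = v & size p = n].

Definition connected_graph := forall u v, exists n, walk_of_length u v n.

Definition infinite_graph := infinite_set [set: G].

Definition acyclic :=
  forall c : seq G, (2 < size c)%N -> ~ ucycle (@adj G) c.

(* junk value 0 when u and v lie in different components *)
Definition dist u v : nat :=
  xget 0%N [set n | walk_of_length u v n /\
                    forall m, walk_of_length u v m -> (n <= m)%N].

(* |u| = |v| - 1, without truncated subtraction: it never holds for v = o *)
Definition closer o v u : bool := (dist o u).+1 == dist o v.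

Definition back_degree o v : nat :=
  #|` fset_set (neighbors v `&` [set u | closer o v u])|%fset.

Section BiasedWalk.
Variables (R : realType) (o : G) (lambda : R).

Definition transition v u : R :=
  if ~~ adj v u then 0
  else if v == o then 1 / (degree v)%:R
  else if closer o v u
       then lambda / ((degree v)%:R + (lambda - 1) * (back_degree o v)%:R)
       else 1 / ((degree v)%:R + (lambda - 1) * (back_degree o v)%:R).

(* P_v(X_n = u), by conditioning on the first step *)
Fixpoint transition_n n v u : R :=
  if n is m.+1 then
    \sum_(w \in neighbors v) transition v w * transition_n m w u
  else (v == u)%:R.

(* The limsup is taken in the extended reals, where it always exists. *)
Definition spectral_radius : \bar R :=
  limn_esup (fun n => (transition_n n o o `^ n%:R^-1)%:E).

End BiasedWalk.
End Graph.

Definition is_isomorphism (G H : graph) (f : G -> H) :=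
  bijective f /\ forall u v, adj (f u) (f v) = adj u v.

Definition isomorphic (G H : graph) := exists f : G -> H, is_isomorphism f.

Definition vertex_transitive (G : graph) :=
  forall u v : G, exists f : G -> G, is_isomorphism f /\ f u = v.

(* The d-regular tree, as the Cayley graph of the free product of d copies of
   Z/2: vertices are the words over d letters without two equal consecutive
   letters, and the neighbors of a word are obtained by adding or deleting its
   first letter. *)
Section RegularTree.
Variable d : nat.

Definition tree_vertex := {s : seq 'I_d | sorted (fun i j => i != j) s}.

Definition tree_adj : rel tree_vertex := fun s t =>
  [exists i, val t == i :: val s] || [exists i, val s == i :: val t].

Lemma tree_adj_sym : symmetric tree_adj.
Proof. by move=> s t; rewrite /tree_adj orbC. Qed.

Lemma tree_adj_irrefl : irreflexive tree_adj.
Proof.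
move=> s; rewrite /tree_adj orbb; apply/existsP => -[i /eqP /(congr1 size)].
by move=> /= /n_Sn.
Qed.

Definition regular_tree : graph := Graph tree_adj_sym tree_adj_irrefl.

Definition tree_root : regular_tree :=
  exist (fun s : seq 'I_d => sorted (fun i j => i != j) s) [::] isT.

Lemma regular_tree_connected : connected_graph regular_tree.
Proof.
have walk_sym (u v : regular_tree) n :
    walk_of_length u v n -> walk_of_length v u n.
  move=> [p [pp <- <-]]; exists (rev (belast u p)); split.
  - by rewrite rev_path (eq_path (e' := @adj regular_tree))// => x y;
      rewrite adj_sym.
  - by case: p {pp} => //= x p; rewrite rev_cons last_rcons.
  - by rewrite size_rev size_belast.
have to_root (u : regular_tree) : walk_of_length u tree_root (size (val u)).
  case: u => s /=; elim: s => [|i s IHs] ss.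
    by exists [::]; split => //; apply: val_inj.
  have ss' := path_sorted ss; have [p [pp pl ps]] := IHs ss'.
  exists (exist _ s ss' :: p); split => //=; last by rewrite ps.
  by rewrite pp andbT; apply/orP; right; apply/existsP; exists i => /=.
move=> u v; have [p [pp pl ps]] := to_root u.
have [q [qp ql qs]] := walk_sym _ _ _ (to_root v).
exists (size (p ++ q)), (p ++ q); split => //.
  by rewrite cat_path pp pl.
by rewrite last_cat pl.
Qed.

Lemma regular_tree_acyclic : acyclic regular_tree.
Proof.
move=> c c2 /andP[cc cu].
have [v vc vmax] : exists2 v, v \in c &
    forall u, u \in c -> (size (val u) <= size (val v))%N.
  case: c c2 {cc cu} => // x c _; elim: c x => [|y c IHc] x.
    by exists x; rewrite ?inE// => u; rewrite inE => /eqP->.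
  have [v vc vmax] := IHc y.
  have [xv|vx] := leqP (size (val x)) (size (val v)).
    by exists v => [|u]; rewrite inE ?vc ?orbT// => /orP[/eqP->|/vmax].
  exists x => [|u]; rewrite inE ?eqxx// => /orP[/eqP->//|/vmax uv].
  exact: leq_trans uv (ltnW vx).
have nbr u : u \in c -> @adj regular_tree v u -> val u = behead (val v).
  move=> uc /orP[/existsP[i /eqP uE]|/existsP[i /eqP ->]//].
  by have := vmax u uc; rewrite uE /= ltnn.
have [i c' cE] := rot_to vc.
have c'c u : u \in v :: c' -> u \in c by rewrite -cE mem_rot.
move: cc cu c2; rewrite -(rot_cycle i) -(rot_uniq i) -(size_rot i c) cE.
case: c' c'c {cE} => // a c' c'c; case/lastP: c' c'c => // c' b c'c.
rewrite /= rcons_path last_rcons => /and3P[va _ bv] /and3P[_ + _] _.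
rewrite mem_rcons inE negb_or => /andP[/eqP + _]; apply.
apply: val_inj; rewrite (nbr a _ va).
  by apply/esym/nbr; [apply: c'c; rewrite !inE mem_rcons inE eqxx !orbT
                     |rewrite adj_sym].
by apply: c'c; rewrite !inE eqxx orbT.
Qed.

Lemma regular_tree_regular : regular regular_tree d.
Proof.
(* multiplication on the left by a letter *)
pose mul (i : 'I_d) (s : seq 'I_d) :=
  if s is j :: s' then if i == j then s' else i :: s else [:: i].
have mulP i s : sorted (fun i j => i != j) s ->
    sorted (fun i j => i != j) (mul i s).
  case: s => //= j s; case: ifPn => [_ /path_sorted//|ij /= ->].
  by rewrite ij.
pose f (v : regular_tree) i : regular_tree := Sub (mul i (val v)) (mulP i _ (valP v)).
have f_inj v : injective (f v).
  move=> i j /(congr1 val); case: v => -[|k s] ss /=; first by case.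
  case: ifPn => [/eqP ik|ik]; case: ifPn => [/eqP jk|jk].
  - by rewrite ik jk.
  - by move=> /(congr1 size)/=; lia.
  - by move=> /(congr1 size)/=; lia.
  - by case.
have nE v : neighbors v = [set` [fset f v i | i in 'I_d]%fset].
  apply/seteqP; split => u; rewrite /neighbors /=.
    move=> /orP[]/existsP[i /eqP uE]; apply/imfsetP; exists i => //;
      apply: val_inj; rewrite /= uE /=; last by rewrite eqxx.
    have := valP u; rewrite uE; case: v {uE} => -[|j s] ss //= /andP[+ _].
    by case: ifP.
  move=> /imfsetP[i _ ->]; rewrite /tree_adj /=; case: v => -[|j s] ss /=.
    by apply/orP; left; apply/existsP; exists i.
  case: ifPn => ij; apply/orP.
    by right; apply/existsP; exists j.
  by left; apply/existsP; exists i.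
split=> v; first by rewrite nE; exact: finite_fset.
by rewrite /degree nE set_fsetK card_imfset//= -cardE card_ord.
Qed.

End RegularTree.

(* Main.v *)
Require Import Defs.
From mathcomp Require Import all_boot all_order all_algebra perm finmap zify ring lra.
From mathcomp Require Import all_classical all_reals all_analysis.

(** Let [b = d - 1], [a = sqrt (lambda / b) < 1] and [rho = 2 a / (1 + a ^ 2)],
    which is the claimed spectral radius of the tree.  On the regular tree the
    function [phi x = ground |x|], with [ground n = a ^ n (1 + slope n)], is a
    positive eigenfunction of the walk for [rho].

    On an arbitrary [d]-regular graph [phi] is a subsolution: moving an edge
    from upwards to sideways or downwards increases the average of the
    decreasing function [phi].  The increase is at least a fixed multiple of
    [phi] at the vertices called merging, which have two neighbours at most as
    far from [o] as themselves, and there is none at the other vertices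
    ([avg_ground_merging], [avg_ground_tree]).  Without merging vertices [phi]
    is an eigenfunction, and the spectral radius is at most [rho]
    ([spectral_radius_tree_like]).

    For lower bounds, the Green function at [s] beyond the spectral radius is
    a positive supersolution, and since the walk is reversible this bounds its
    quadratic form on finitely supported functions by [s]
    ([form_le_spectral_radius]).  The test functions are the truncations of
    [phi] to balls.  Their quadratic form is at least [rho] times their energy
    plus the gain at merging vertices, up to a boundary term, the energy of
    the last sphere ([form_ge]).  Spheres have at most about [b ^ n] vertices,
    so that the energy of balls grows at most like the cube of the radius
    ([energy_poly]), and the boundary term cannot always be a fixed proportion
    of it ([cubic_growth]).  Hence the spectral radius is at least [rho]
    ([spectral_radius_ge]), and strictly larger if merging vertices occur
    within bounded distance of every vertex ([spectral_radius_gt]).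

    The farthest vertex of a cycle is merging, so a transitive graph with a
    cycle falls under the strict case ([transitive_merging]), while an acyclic
    graph has no merging vertex ([acyclic_not_merging]).  Finally a connected
    acyclic [d]-regular graph is the tree: its edges can be labelled
    compatibly with the words that are the vertices of the tree
    ([isomorphic_regular_tree]). *)

Set Implicit Arguments.
Unset Strict Implicit.
Unset Printing Implicit Defensive.

Import Order.TTheory GRing.Theory Num.Theory.
Import numFieldNormedType.Exports.

Local Open Scope classical_set_scope.
Local Open Scope ring_scope.

(** * Distance to the root and merging vertices *)

Section Distance.
Variable G : graph.
Hypothesis G_connected : connected_graph G.
Implicit Types (o u v w : G) (n : nat).

Lemma distP u v : walk_of_length u v (dist u v) /\
  forall n, walk_of_length u v n -> (dist u v <= n)%N.
Proof.
rewrite /dist; case: xgetP => [n -> //|none].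
have ex : exists n, `[< walk_of_length u v n >].
  by have [n w] := G_connected u v; exists n; apply/asboolP.
have [n /asboolP nw nmin] := ex_minnP ex.
by case: (none n); split=> // m mw; apply: nmin; apply/asboolP.
Qed.

Lemma dist_walk u v : walk_of_length u v (dist u v).
Proof. by case: (distP u v). Qed.

Lemma dist_le u v n : walk_of_length u v n -> (dist u v <= n)%N.
Proof. by case: (distP u v) => _; apply. Qed.

Lemma walk_rcons u v w n :
  walk_of_length u v n -> adj v w -> walk_of_length u w n.+1.
Proof.
move=> [p [pp <- <-]] vw; exists (rcons p w); split.
- by rewrite rcons_path pp.
- by rewrite last_rcons.
- by rewrite size_rcons.
Qed.

Lemma dist_adj o v w : adj v w -> (dist o w <= (dist o v).+1)%N.
Proof. by move=> vw; apply/dist_le/(walk_rcons (dist_walk o v)). Qed.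

Lemma dist_root o : dist o o = 0%N.
Proof. by apply/eqP; rewrite -leqn0; apply: dist_le; exists [::]. Qed.

Lemma dist_eq0 o v : dist o v = 0%N -> v = o.
Proof.
by move=> d0; have := dist_walk o v; rewrite d0 => -[p [_ <- /size0nil ->]].
Qed.

Lemma closer_adj o v : v != o -> exists2 w, adj v w & closer o v w.
Proof.
move=> vo; case: (dist_walk o v) => p; case/lastP: p => [|p w].
  by case=> _ /= ov _; rewrite ov eqxx in vo.
rewrite rcons_path last_rcons size_rcons => -[/andP[pp lw] wv sp].
exists (last o p); first by rewrite adj_sym -wv.
rewrite /closer eqn_leq -sp ltnS; apply/andP; split.
  by apply: dist_le; exists p.
by rewrite sp; apply: dist_adj; rewrite -wv.
Qed.

(** A graph without such vertices looks, level by level, like a tree rooted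
    at [o]: one neighbour below, all others above.  Neighbours on the same
    level count, so that cycles of odd length are detected as well. *)
Definition merging o v := exists w1 w2,
  [/\ w1 != w2, adj v w1, adj v w2, (dist o w1 <= dist o v)%N
    & (dist o w2 <= dist o v)%N].

Definition near_merging o k v := exists w n,
  [/\ (n <= k)%N, walk_of_length v w n & merging o w].

Lemma near_merging0 o v : near_merging o 0 v -> merging o v.
Proof. by move=> [w [n [+ [[|y s] [_ /= <- sn]] wm]]] => [//|]; rewrite -sn. Qed.

Lemma near_mergingS o k v : near_merging o k.+1 v ->
  near_merging o k v \/ exists2 w, adj v w & near_merging o k w.
Proof.
move=> [w [[|n] [nk [[|y s] [ps sl sn]] wm]]] //.
  by left; exists w, 0%N; split=> //; exists [::].
move: ps => /= /andP[vy ps]; right; exists y => //.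
exists w, n; split=> //; exists s; split=> //; by case: sn.
Qed.

Lemma merging_neq_root o v : merging o v -> v != o.
Proof.
move=> [w1 [w2 [_ vw1 _ + _]]]; apply: contraPneq => vo.
rewrite vo dist_root leqn0 => /eqP /dist_eq0 w1o.
by rewrite vo w1o adj_irrefl in vw1.
Qed.

(** A vertex of the cycle farthest from [o] is merging, because of its two
    neighbours along the cycle. *)
Lemma cycle_merging o (c : seq G) : (2 < size c)%N -> ucycle (@adj G) c ->
  exists2 v, v \in c & merging o v.
Proof.
move=> c2 /andP[cc cu].
have [v vc vmax] : exists2 v, v \in c &
    forall u, u \in c -> (dist o u <= dist o v)%N.
  case: c c2 {cc cu} => // x c _; elim: c x => [|y c IHc] x.
    by exists x; rewrite ?inE// => u; rewrite inE => /eqP->.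
  have [v vc vmax] := IHc y.
  have [xv|vx] := leqP (dist o x) (dist o v).
    by exists v => [|u]; rewrite inE ?vc ?orbT// => /orP[/eqP->|/vmax].
  exists x => [|u]; rewrite inE ?eqxx// => /orP[/eqP->//|/vmax uv].
  exact: leq_trans uv (ltnW vx).
exists v => //.
have [i c' cE] := rot_to vc.
have c'c u : u \in v :: c' -> u \in c by rewrite -cE mem_rot.
move: cc cu c2; rewrite -(rot_cycle i) -(rot_uniq i) -(size_rot i c) cE.
case: c' c'c {cE} => // a c' c'c; case/lastP: c' c'c => // c' b c'c.
rewrite /= rcons_path last_rcons => /and3P[va _ bv] /and3P[_ + _] _.
rewrite mem_rcons inE negb_or => /andP[ab _].
exists a, b; split=> //; first by rewrite adj_sym.
- by apply: vmax; apply: c'c; rewrite !inE eqxx orbT.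
- by apply: vmax; apply: c'c; rewrite !inE mem_rcons inE eqxx !orbT.
Qed.

Lemma descent o w : exists p, [/\ path (@adj G) w p, last w p = o
  & {in p, forall u, dist o u < dist o w}%N].
Proof.
move: {2}(dist o w) (erefl (dist o w)) => n.
elim: n w => [|n IHn] w wn; first by exists [::]; rewrite (dist_eq0 wn).
have wo : w != o by apply: contra_eq_neq wn => ->; rewrite dist_root.
have [w' ww' /eqP cw] := closer_adj wo.
have [|p [pp pl pd]] := IHn w'; first by move: cw; rewrite wn => -[].
exists (w' :: p); split=> [||u] //=; first by rewrite ww'.
by rewrite inE -cw => /orP[/eqP -> //|/pd /ltnW]; rewrite ltnS.
Qed.

(** Two descending walks from the two neighbours to [o] avoid the vertex
    itself, so that they close up to a cycle through it. *)
Lemma acyclic_not_merging o v : acyclic G -> ~ merging o v.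
Proof.
move=> Gac [w1 [w2 [w12 vw1 vw2 d1 d2]]].
have avoid w p : adj v w -> (dist o w <= dist o v)%N ->
    {in p, forall u, dist o u < dist o w}%N -> v \notin w :: p.
  move=> vw wv pd; rewrite inE negb_or; apply/andP; split.
    by apply: contraTneq vw => ->; rewrite adj_irrefl.
  by apply: contraTN wv => /pd; rewrite -ltnNge.
have [p1 [pp1 pl1 /(avoid _ _ vw1 d1) pv1]] := descent o w1.
have [p2 [pp2 pl2 /(avoid _ _ vw2 d2) pv2]] := descent o w2.
pose q := p1 ++ rev (belast w2 p2).
have qp : path (@adj G) w1 q.
  rewrite cat_path pp1 pl1 -pl2 rev_path.
  by rewrite (eq_path (e' := @adj G)) // => x y; rewrite adj_sym.
have ql : last w1 q = w2.
  rewrite last_cat pl1; case: p2 {pp2 pv2 q qp} pl2 => [//|x p2] _ /=.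
  by rewrite rev_cons last_rcons.
have qv : v \notin w1 :: q.
  rewrite -cat_cons mem_cat mem_rev negb_or pv1.
  by apply: contra pv2 => /mem_belast.
case/shortenP: qp ql => q' qp' qu' qq' ql'.
have qv' : v \notin w1 :: q'.
  apply: contra qv; rewrite !inE => /orP[->//|/qq' ->]; exact: orbT.
apply: (Gac (v :: w1 :: q')).
  by case: q' ql' {qp' qu' qq' qv'} => [/= e|//]; rewrite e eqxx in w12.
apply/andP; split; last by rewrite cons_uniq qv' qu'.
by rewrite /= rcons_path vw1 qp' ql' adj_sym.
Qed.
End Distance.

(** * Cycles and isomorphisms *)

Lemma cycle_walk (G : graph) (c : seq G) (x y : G) : cycle (@adj G) c ->
  x \in c -> y \in c -> exists2 n, (n <= size c)%N & walk_of_length x y n.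
Proof.
move=> cc /rot_to[i c' cE] yc.
have {}yc : y \in x :: c' by rewrite -cE mem_rot.
move: cc; rewrite -(rot_cycle i) -(size_rot i c) cE /= rcons_path => /andP[pc _].
case/splitPl: yc pc => p1 p2 pl; rewrite cat_path => /andP[pp1 _].
by exists (size p1); [rewrite /= size_cat; lia|exists p1].
Qed.

Lemma ucycle_map (G H : graph) (f : G -> H) (c : seq G) :
  is_isomorphism f -> ucycle (@adj G) c -> ucycle (@adj H) (map f c).
Proof.
move=> [fb fadj] /andP[cc cu]; apply/andP; split.
  rewrite cycle_map (eq_cycle (e' := @adj G)) // => x y; exact: fadj.
by rewrite map_inj_uniq //; exact: bij_inj.
Qed.

Lemma isomorphic_acyclic (G H : graph) : isomorphic G H -> acyclic H -> acyclic G.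
Proof.
move=> [f iso_f] Hac c c2 cc; apply: (Hac (map f c)).
  by rewrite size_map.
exact: ucycle_map.
Qed.

(** Transitivity carries one cycle to every vertex, and each of its copies
    contains a merging vertex. *)
Lemma transitive_merging (G : graph) (o : G) :
  vertex_transitive G -> ~ acyclic G ->
  exists L, forall x : G, near_merging o L x.
Proof.
move=> Gt /existsNP[c /not_implyP[c2 /contrapT cc]].
exists (size c) => x; case: c c2 cc => // y c c2 cc.
have [f [iso_f fy]] := Gt y x.
have fcc := ucycle_map iso_f cc.
have [|v vc vm] := cycle_merging o _ fcc; first by rewrite size_map.
have xc : x \in map f (y :: c) by rewrite /= fy inE eqxx.
have [n nc w] := cycle_walk (ucycle_cycle fcc) xc vc.
by exists v, n; split=> //; rewrite size_map in nc.
Qed.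

(** * Acyclic regular graphs are regular trees *)

Section TreeIsomorphism.
Variables (G : graph) (d : nat) (o : G).
Hypothesis G_connected : connected_graph G.
Hypothesis G_acyclic : acyclic G.
Hypothesis G_regular : regular G d.
Implicit Types (v w p : G) (s t : seq 'I_d) (i j : 'I_d).

Lemma mem_neighbors (v w : G) : (w \in fset_set (neighbors v)) = adj v w.
Proof.
by rewrite in_fset_set; [rewrite /neighbors mem_setE|exact: (proj1 G_regular)].
Qed.

Definition enum_neighbors (v : G) (i : 'I_d) : G :=
  nth v (fset_set (neighbors v)) i.

Lemma size_neighbors v : size (fset_set (neighbors v)) = d.
Proof. exact: (proj2 G_regular). Qed.

Lemma enum_neighbors_adj v i : adj v (enum_neighbors v i).
Proof. by rewrite -mem_neighbors mem_nth // size_neighbors. Qed.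

Lemma enum_neighbors_inj v : injective (enum_neighbors v).
Proof.
move=> i j /eqP; rewrite /enum_neighbors nth_uniq ?size_neighbors //.
  by move=> /eqP /val_inj.
Qed.

Lemma enum_neighbors_onto v w : adj v w -> exists i, enum_neighbors v i = w.
Proof.
rewrite -mem_neighbors => vw.
have iw : (index w (fset_set (neighbors v)) < d)%N.
  by rewrite -(size_neighbors v) index_mem.
by exists (Ordinal iw); rewrite /enum_neighbors /= nth_index.
Qed.

(** In the regular tree an edge carries the same letter seen from both ends.
    To imitate this, the enumeration of the neighbours of [v] is changed by a
    transposition so that the vertex [p] from which [v] is reached through
    the letter [j] gets the letter [j] as well. *)
Definition label (v p : G) (j i : 'I_d) : G :=
  enum_neighbors v (tperm j (odflt j [pick k | enum_neighbors v k == p]) i).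

Lemma label_adj v p j i : adj v (label v p j i).
Proof. exact: enum_neighbors_adj. Qed.

Lemma label_inj v p j : injective (label v p j).
Proof. by move=> i k /enum_neighbors_inj /perm_inj. Qed.

Lemma label_onto v p j w : adj v w -> exists i, label v p j i = w.
Proof.
move=> /enum_neighbors_onto[i <-].
pose t := tperm j (odflt j [pick k | enum_neighbors v k == p]).
by exists (t i); rewrite /label tpermK.
Qed.

Lemma label_back v p j : adj v p -> label v p j j = p.
Proof.
move=> /enum_neighbors_onto[i ip]; rewrite /label tpermL; case: pickP => /=.
  by move=> k /eqP.
by move=> /(_ i); rewrite ip eqxx.
Qed.

(** The vertex reached from [o] by following the letters of a word from the
    last to the first.  Thanks to [label] the walk turns back exactly when a
    letter is repeated. *)
Fixpoint place (s : seq 'I_d) : G :=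
  if s is i :: s' then
    if s' is j :: s'' then label (place s') (place s'') j i
    else enum_neighbors o i
  else o.

Local Notation reduced := (sorted (fun i j : 'I_d => i != j)).

Lemma place_adj i s : adj (place s) (place (i :: s)).
Proof.
by case: s => [|j s]; [exact: enum_neighbors_adj|exact: label_adj].
Qed.

Lemma place_back i s : place s = label (place (i :: s)) (place s) i i.
Proof. by rewrite label_back // adj_sym place_adj. Qed.

Lemma not_merging_eq v w1 w2 : adj v w1 -> adj v w2 ->
  (dist o w1 <= dist o v)%N -> (dist o w2 <= dist o v)%N -> w1 = w2.
Proof.
move=> vw1 vw2 d1 d2; apply: contrapT => /eqP w12.
by apply: (@acyclic_not_merging _ G_connected o v G_acyclic); exists w1, w2.
Qed.

(** If the walk came closer to [o] at some step, it would do so towards the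
    only neighbour that is not farther away, namely the previous vertex; the
    two labels would then be equal. *)
Lemma dist_place s : reduced s -> dist o (place s) = size s.
Proof.
have [n] := ubnP (size s); elim: n s => // n IHn [_ _|i s sn ris].
  exact: dist_root.
have rs := path_sorted ris; have ds := IHn s sn rs.
have le1 := dist_adj G_connected o (place_adj i s).
apply/eqP; rewrite eqn_leq [size _]/= -{1}ds le1 ltnNge; apply/negP => le2.
case: s sn ris rs ds le1 le2 => [|j s] sn ris rs ds le1 le2.
  move: le2; rewrite leqn0 => /eqP /(dist_eq0 G_connected) oi.
  by have := place_adj i [::]; rewrite oi adj_irrefl.
have ij : i != j by case/andP: ris.
have ds' := IHn s (ltnW sn) (path_sorted rs).
case/eqP: ij; apply: (@label_inj (place (j :: s)) (place s) j).
rewrite -place_back; apply: (@not_merging_eq (place (j :: s))).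
- exact: label_adj.
- by rewrite adj_sym place_adj.
- by rewrite ds.
- by rewrite ds ds' leqnSn.
Qed.

(** All other neighbours of [place (i :: s)] are strictly farther from [o]:
    this is what makes [place] injective and reflect adjacency. *)
Lemma place_parent_eq i s v : reduced (i :: s) -> adj (place (i :: s)) v ->
  (dist o v <= size (i :: s))%N -> v = place s.
Proof.
move=> ris sv vs; apply: (@not_merging_eq (place (i :: s))) => //.
- by rewrite adj_sym place_adj.
- by rewrite dist_place.
- by rewrite !dist_place ?(path_sorted ris) //= leqnSn.
Qed.

Lemma place_inj s t : reduced s -> reduced t -> place s = place t -> s = t.
Proof.
elim: s t => [|i s IHs] [|j t] rs rt st //.
- by have := dist_place rt; rewrite -st dist_place.
- by have := dist_place rs; rewrite st dist_place.
have [e] : size (i :: s) = size (j :: t) by rewrite -!dist_place ?st.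
have {}e : s = t.
  apply: IHs; [exact: path_sorted rs|exact: path_sorted rt|].
  apply: place_parent_eq rt _ _; first by rewrite -st adj_sym place_adj.
  by rewrite dist_place ?(path_sorted rs) //= e leqnSn.
subst t; congr (_ :: _).
case: s {rs rt IHs} st => [|k s] /=; first exact: enum_neighbors_inj.
exact: label_inj.
Qed.

Lemma place_onto v : exists2 s, reduced s & place s = v.
Proof.
move: {2}(dist o v) (erefl (dist o v)) => n.
elim: n v => [|n IHn] v vn.
  by exists [::]; rewrite //= (dist_eq0 G_connected vn).
have vo : v != o by apply: contra_eq_neq vn => ->; rewrite (dist_root G_connected).
have [w vw /eqP cw] := closer_adj G_connected vo.
have [|s rs sw] := IHn w; first by move: cw; rewrite vn => -[].
rewrite adj_sym -sw in vw; case: s rs sw vw => [|j s] rs sw vw.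
  by have [i iv] := enum_neighbors_onto vw; exists [:: i].
have [i iv] := label_onto (place s) j vw.
exists [:: i, j & s] => //=; rewrite -/(reduced (j :: s)).
move: (rs) => /= ->; rewrite andbT; apply: contra_eq_neq vn => ij.
have vs : v = place s by rewrite -iv ij label_back // adj_sym place_adj.
move: cw; rewrite -sw vs !dist_place ?(path_sorted rs) //=; lia.
Qed.

Definition tree_place (s : regular_tree d) : G := place (val s).

Lemma tree_place_inj : injective tree_place.
Proof. by move=> s t /(place_inj (valP s) (valP t)) /val_inj. Qed.

Lemma tree_place_onto v : exists s : regular_tree d, tree_place s = v.
Proof. by have [s rs sv] := place_onto v; exists (exist _ s rs). Qed.

Lemma tree_place_adj (s t : regular_tree d) : adj (tree_place s) (tree_place t) = adj s t.
Proof.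
apply/idP/idP => [|/orP[/existsP[i /eqP it]|/existsP[i /eqP is_]]].
- wlog : s t / (size (val s) <= size (val t))%N => [hw|].
    have [st|/ltnW ts] := leqP (size (val s)) (size (val t)); first exact: hw.
    by move=> a; rewrite adj_sym; apply: hw => //; rewrite adj_sym.
  case: t => -[|j t] rt st adj_st.
    case: s st adj_st => -[|//] rs _; rewrite /tree_place /=.
    by rewrite adj_irrefl.
  apply/orP; left; apply/existsP; exists j; apply/eqP => /=; congr (_ :: _).
  apply: place_inj; [exact: path_sorted (rt)|exact: valP|apply/esym].
  apply: (place_parent_eq rt); first by rewrite adj_sym.
  by rewrite dist_place //; exact: valP.
- by rewrite /tree_place it place_adj.
- by rewrite /tree_place is_ adj_sym place_adj.
Qed.

Lemma isomorphic_regular_tree : isomorphic G (regular_tree d).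
Proof.
pose f v := sval (cid (tree_place_onto v)).
have fK : cancel f tree_place by move=> v; rewrite /f; case: cid.
have Kf : cancel tree_place f by move=> s; apply: tree_place_inj; rewrite fK.
exists f; split; first by exists tree_place.
by move=> u v; rewrite -tree_place_adj !fK.
Qed.

End TreeIsomorphism.

(** * Upper limits, finite sums and growth *)

Lemma limn_esup_lt (R : realType) (u : nat -> R) (s : R) :
  (limn_esup (fun n => (u n)%:E) < s%:E)%E ->
  exists N, forall n, (N <= n)%N -> u n < s.
Proof.
move=> /ereal_inf_lt[_ [V [N _ NV] <-] Vs]; exists N => n Nn.
rewrite -lte_fin; apply: le_lt_trans Vs; apply: ereal_sup_ubound.
by exists n => //; exact: NV.
Qed.

Lemma limn_esup_le (R : realType) (u : nat -> R) (s : R) :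
  (forall n, (0 < n)%N -> u n <= s) ->
  (limn_esup (fun n => (u n)%:E) <= s%:E)%E.
Proof.
move=> us; apply: ge_ereal_inf.
exists (ereal_sup [set (u n)%:E | n in [set n | (1 <= n)%N]]).
  by exists [set n | (1 <= n)%N] => //; exists 1%N.
by apply: ge_ereal_sup => _ [n n0 <-]; rewrite lee_fin us.
Qed.

Lemma sum_fsetC (R : nmodType) (T : choiceType) (A B : {fset T}) (F : T -> R) :
  \sum_(x <- A | x \in B) F x = \sum_(x <- B | x \in A) F x.
Proof.
rewrite -big_filter -[RHS]big_filter; apply: perm_big; apply: uniq_perm.
- exact/filter_uniq/fset_uniq.
- exact/filter_uniq/fset_uniq.
- by move=> x; rewrite !mem_filter andbC.
Qed.

(** Exponential growth beats a cubic bound: with [1 + eta >= (1 + e) ^+ 4],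
    Bernoulli's inequality makes [A (k * L.+1)] grow at least like
    [(1 + e * k%:R) ^+ 4]. *)
Lemma cubic_growth (R : realType) (A : nat -> R) (L : nat) (C eta : R) :
  0 < A 0%N -> 0 < eta -> (forall n, A n <= C * n.+1%:R ^+ 3) ->
  ~ (forall n, (1 + eta) * A n <= A (n + L.+1)%N).
Proof.
move=> A0 eta0 AC grow.
(* 15 = 2 ^ 4 - 1 bounds the sum of the remaining binomial coefficients. *)
pose e := Num.min eta 1 / 15.
have e0 : 0 < e by rewrite divr_gt0 // lt_min eta0 ltr01.
have e4 : (1 + e) ^+ 4 <= 1 + eta.
  have e1 : 15 * e <= 1 by rewrite /e mulrC divfK // ge_min lexx orbT.
  have e2 : 15 * e <= eta by rewrite /e mulrC divfK // ge_min lexx.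
  have : e ^+ 2 <= e by rewrite expr2 ler_piMl ?(ltW e0) //; lra.
  have : e ^+ 3 <= e by rewrite exprS ler_piMr ?(ltW e0) // exprn_ile1 ?(ltW e0) //; lra.
  have : e ^+ 4 <= e by rewrite exprS ler_piMr ?(ltW e0) // exprn_ile1 ?(ltW e0) //; lra.
  lra.
have grow_pow k : (1 + eta) ^+ k * A 0%N <= A (k * L.+1)%N.
  elim: k => [|k IHk]; first by rewrite mul1r.
  rewrite mulSn addnC; apply: le_trans (grow _).
  by rewrite exprS -mulrA ler_pM2l // addr_gt0.
have bernoulli k : 1 + e * k%:R <= (1 + e) ^+ k.
  elim: k => [|k IHk]; first by rewrite mulr0 addr0.
  rewrite exprS -natr1; apply: le_trans (ler_wpM2l _ IHk); last by lra.
  have := mulr_ge0 (ltW (mulr_gt0 e0 e0)) (ler0n R k); nra.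
have C0 : 0 < C.
  have := lt_le_trans A0 (AC 0%N); by rewrite expr1n mulr1.
(* For [k] with [D < 1 + e * k%:R] the fourth power exceeds the cubic bound. *)
pose D := C * (L.+1%:R / e + 1) ^+ 3 / A 0%N.
have D0 : 0 < D.
  rewrite divr_gt0 ?A0 // mulr_gt0 // exprn_gt0 // ltr_wpDl //.
  by rewrite divr_ge0 // ltW.
pose k := Num.bound (D / e).
have Dk : D < 1 + e * k%:R.
  have : D / e < k%:R by apply: archi_boundP; rewrite divr_ge0 // ltW.
  by rewrite ltr_pdivrMr // mulrC; lra.
have X0 : 0 < 1 + e * k%:R := lt_trans D0 Dk.
have lower : (1 + e * k%:R) ^+ 4 <= (1 + eta) ^+ k.
  have e1 : 0 < 1 + e by rewrite addr_gt0.
  apply: (@le_trans _ _ (((1 + e) ^+ 4) ^+ k)).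
    by rewrite exprAC lerXn2r ?nnegrE ?exprn_ge0 ?(ltW e1) ?(ltW X0).
  by rewrite lerXn2r ?nnegrE ?exprn_ge0 ?(ltW e1) ?addr_ge0 ?(ltW eta0).
have upper : (k * L.+1).+1%:R <= (L.+1%:R / e + 1) * (1 + e * k%:R).
  rewrite -natr1 natrM.
  have -> : (L.+1%:R / e + 1) * (1 + e * k%:R) =
      k%:R * L.+1%:R + 1 + (L.+1%:R / e + e * k%:R).
    by field; rewrite gt_eqF.
  by rewrite lerDl; apply: addr_ge0; [apply: divr_ge0|apply: mulr_ge0] => //; exact: ltW.
have := le_trans (grow_pow k) (AC _); apply/negP; rewrite -ltNge.
apply: (@le_lt_trans _ _ (C * ((L.+1%:R / e + 1) * (1 + e * k%:R)) ^+ 3)).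
  by rewrite ler_pM2l // lerXn2r // nnegrE // (le_trans _ upper).
apply: (@lt_le_trans _ _ ((1 + e * k%:R) ^+ 4 * A 0%N)); last first.
  by rewrite ler_pM2r ?A0.
rewrite exprMn mulrA [_ ^+ 4]exprS [ltRHS]mulrAC ltr_pM2r ?exprn_gt0 //.
by rewrite -ltr_pdivrMr ?A0.
Qed.

(** * The biased walk as a reversible chain *)

Section Walk.
Variables (R : realType) (G : graph) (d : nat) (o : G) (lambda : R).
Hypothesis d_ge2 : (2 <= d)%N.
Hypothesis G_regular : regular G d.
Hypothesis G_connected : connected_graph G.
Hypothesis lambda_gt0 : 0 < lambda.
Implicit Types (x y z u v w : G) (f g : G -> R).

Local Notation nb x := (fset_set (neighbors x)).
Local Notation p n x y := (transition_n o lambda n x y).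

(** The root needs no separate case: none of its neighbours is closer to it. *)
Definition weight x y : R := if closer o x y then lambda else 1.

Definition total_weight x : R := \sum_(y <- nb x) weight x y.

Lemma weight_gt0 x y : 0 < weight x y.
Proof. by rewrite /weight; case: ifP. Qed.

Lemma sum_nb_const x (c : R) : \sum_(y <- nb x) c = c *+ d.
Proof. by rewrite big_const_seq count_predT (size_neighbors G_regular) iter_addr_0. Qed.

Lemma total_weight_gt0 x : 0 < total_weight x.
Proof.
have : (0 < size (nb x))%N by rewrite (size_neighbors G_regular) ltnW.
rewrite /total_weight; case: {1 2}(enum_fset _) => // y s _.
by rewrite big_cons ltr_wpDr ?weight_gt0 // sumr_ge0 // => z _; exact/ltW/weight_gt0.
Qed.

Lemma total_weight_le x : total_weight x <= d%:R * (1 + lambda).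
Proof.
rewrite mulr_natl -(sum_nb_const x); apply: ler_sum => y _.
by rewrite /weight; case: ifP => _; have := lambda_gt0; lra.
Qed.

Lemma total_weightE x :
  total_weight x = (degree x)%:R + (lambda - 1) * (back_degree o x)%:R.
Proof.
rewrite (proj2 G_regular) -[d%:R](sum_nb_const x 1).
have -> : (back_degree o x)%:R = \sum_(y <- nb x) (closer o x y)%:R :> R.
  rewrite (bigID (closer o x)) /= [X in _ + X]big1 ?addr0; last first.
    by move=> y /negbTE ->.
  rewrite (eq_bigr (fun=> 1)); last by move=> y ->.
  rewrite big_const_seq iter_addr_0; congr (_%:R).
  rewrite -size_filter /back_degree; apply: perm_size; apply: uniq_perm.
  - exact: fset_uniq.
  - exact/filter_uniq/fset_uniq.
  move=> y; rewrite mem_filter (mem_neighbors G_regular) in_fset_set.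
    by rewrite in_setI !mem_setE andbC.
  by apply: finite_setIl; exact: (proj1 G_regular).
rewrite mulr_sumr -big_split /=; apply: eq_bigr => y _.
by rewrite /weight; case: ifP => _ /=; ring.
Qed.

Lemma transitionE x y : adj x y ->
  transition o lambda x y = weight x y / total_weight x.
Proof.
move=> xy; rewrite /transition xy /= total_weightE /weight.
case: eqVneq => [->|_]; last by case: ifP.
have nc z : closer o o z = false by rewrite /closer (dist_root G_connected).
rewrite nc /back_degree (_ : _ `&` _ = set0).
  by rewrite fset_set0 cardfs0 mulr0 addr0.
by rewrite -subset0 => z []; rewrite /= nc.
Qed.

(** The transition operator of the walk. *)
Definition avg g x : R := (\sum_(y <- nb x) weight x y * g y) / total_weight x.

Lemma transition_nS n x z : p n.+1 x z = avg (fun y => p n y z) x.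
Proof.
rewrite /= fsbig_finite; last exact: (proj1 G_regular).
rewrite /avg mulr_suml; apply: eq_big_seq => y; rewrite (mem_neighbors G_regular) => xy.
by rewrite transitionE // mulrAC.
Qed.

Lemma avg_le g h x : (forall y, adj x y -> g y <= h y) -> avg g x <= avg h x.
Proof.
move=> gh; rewrite ler_pM2r ?invr_gt0 ?total_weight_gt0 //.
rewrite big_seq [leRHS]big_seq; apply: ler_sum => y.
by rewrite (mem_neighbors G_regular) => /gh; rewrite ler_pM2l ?weight_gt0.
Qed.

Lemma avgZ (c : R) g x : avg (fun y => c * g y) x = c * avg g x.
Proof.
rewrite /avg mulrA mulr_sumr; congr (_ / _).
by apply: eq_bigr => y _; rewrite mulrCA.
Qed.

Lemma avg0 x : avg (fun=> 0) x = 0.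
Proof. by rewrite /avg big1 ?mul0r // => y _; rewrite mulr0. Qed.

Lemma transition_n_ge0 n x z : 0 <= p n x z.
Proof.
elim: n x => [|n IHn] x; first by rewrite /= ler0n.
by rewrite transition_nS -[leLHS](avg0 x); apply: avg_le.
Qed.

Lemma transition_n_walk x z n : walk_of_length x z n -> 0 < p n x z.
Proof.
move=> [s [ps <- <-]]; elim: s x ps => [|y s IHs] x; first by rewrite /= eqxx.
move=> /= /andP[xy ps]; rewrite -/(p (size s).+1 x _) transition_nS.
rewrite divr_gt0 ?total_weight_gt0 //.
have := xy; rewrite -(mem_neighbors G_regular) => yx.
rewrite (big_rem y yx) /= ltr_wpDr ?mulr_gt0 ?weight_gt0 ?IHs //.
by apply: sumr_ge0 => w _; rewrite mulr_ge0 ?transition_n_ge0 ?ltW ?weight_gt0.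
Qed.

Lemma transition_nD m n x y z : p m x y * p n y z <= p (m + n) x z.
Proof.
elim: m x => [|m IHm] x.
  rewrite /= add0n; case: eqVneq => [->|_]; first by rewrite mul1r.
  by rewrite mul0r transition_n_ge0.
rewrite addSn !transition_nS mulrC -avgZ; apply: avg_le => w _.
by rewrite mulrC.
Qed.

Lemma spectral_radius_lt (s : R) : (spectral_radius o lambda < s%:E)%E ->
  exists N, forall n, (N < n)%N -> p n o o <= s ^+ n.
Proof.
move=> /limn_esup_lt[N Ns]; exists N => n Nn.
have n0 : (0 < n)%N by exact: leq_ltn_trans Nn.
have pn := transition_n_ge0 n o o; have sn := Ns n (ltnW Nn).
have -> : p n o o = (p n o o `^ n%:R^-1) ^+ n.
  by rewrite -powR_mulrn ?powR_ge0 // -powRrM mulVf ?powRr1 // pnatr_eq0 -lt0n.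
by rewrite lerXn2r ?nnegrE ?powR_ge0 ?(ltW sn) // (le_trans _ (ltW sn)) ?powR_ge0.
Qed.

Lemma spectral_radius_le (s : R) : 0 <= s ->
  (forall n, p n o o <= s ^+ n) -> (spectral_radius o lambda <= s%:E)%E.
Proof.
move=> s0 ps; apply: limn_esup_le => n n0.
have -> : s = (s ^+ n) `^ n%:R^-1.
  by rewrite -powR_mulrn // -powRrM mulfV ?powRr1 // pnatr_eq0 -lt0n.
by apply: ge0_ler_powR; rewrite ?nnegrE ?invr_ge0 ?ler0n ?exprn_ge0 ?transition_n_ge0.
Qed.

Lemma avg_sum (I : Type) (r : seq I) (F : I -> G -> R) x :
  avg (fun y => \sum_(i <- r) F i y) x = \sum_(i <- r) avg (F i) x.
Proof.
rewrite /avg -mulr_suml exchange_big; congr (_ / _) => /=.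
by apply: eq_bigr => y _; rewrite mulr_sumr.
Qed.

(** * The quadratic form of the walk and the spectral radius *)

(** The hypothesis bounds returns to [o]; a return path through [x] extends
    the bound to walks from [x] to [o]. *)
Lemma transition_n_geometric (t : R) x : 0 < t ->
  (spectral_radius o lambda < t%:E)%E ->
  exists C, forall n, p n x o <= C * t ^+ n.
Proof.
move=> t0 /spectral_radius_lt[N pN].
have [k /transition_n_walk q0] := G_connected o x.
(* [C1] takes care of the large values of [n], [C2] of the others. *)
pose C1 := t ^+ k / p k o x; pose C2 := \sum_(i < N.+1) p i x o / t ^+ i.
have C1_ge0 : 0 <= C1 by rewrite divr_ge0 ?exprn_ge0 // ltW.
have term_ge0 i : 0 <= p i x o / t ^+ i.
  by rewrite divr_ge0 ?exprn_ge0 ?transition_n_ge0 // ltW.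
exists (C1 + C2) => n; rewrite -ler_pdivrMr ?exprn_gt0 //.
have [nN|Nn] := leqP n N.
  have nN' : (n < N.+1)%N by [].
  rewrite /C2 (bigD1 (Ordinal nN')) //= addrCA ler_wpDr // addr_ge0 //.
  exact: sumr_ge0.
rewrite ler_wpDr //; first exact: sumr_ge0.
rewrite ler_pdivrMr ?exprn_gt0 // /C1 mulrAC ler_pdivlMr //.
rewrite -exprD mulrC (le_trans (transition_nD _ _ _ _ _)) // pN //.
exact: ltn_addl.
Qed.

(** The supersolution is the Green function
    [u x = \sum_n p n x o / s ^+ n], which satisfies
    [avg u x = s * (u x - (x == o)%:R)]. *)
Lemma supersolution (t s : R) : 0 < t < s ->
  (spectral_radius o lambda < t%:E)%E ->
  exists u : G -> R, (forall x, 0 < u x) /\ (forall x, avg u x <= s * u x).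
Proof.
move=> /andP[t0 ts] spt; have s0 : 0 < s := lt_trans t0 ts.
pose U x : nat -> R := series (fun n => p n x o / s ^+ n).
have term_ge0 n x : 0 <= p n x o / s ^+ n.
  by rewrite divr_ge0 ?exprn_ge0 ?transition_n_ge0 // ltW.
have U_nd x : nondecreasing_seq (U x).
  by apply/nondecreasing_seqP => n; rewrite /U /series /= big_nat_recr //= ler_wpDr.
have U_cvg x : cvgn (U x).
  have [C pC] := transition_n_geometric x t0 spt.
  have le_geo n : p n x o / s ^+ n <= geometric C (t / s) n.
    by rewrite /geometric /= expr_div_n mulrA ler_pM2r ?invr_gt0 ?exprn_gt0.
  apply: (series_le_cvg _ _ le_geo) => [//|n|].
    exact: le_trans (le_geo n).
  apply: is_cvg_geometric_series.
  by rewrite ger0_norm ?divr_ge0 ?ltW // ltr_pdivrMr // mul1r.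
pose u x := limn (U x); exists u; split=> x.
  have [k /transition_n_walk q0] := G_connected x o.
  apply: lt_le_trans (nondecreasing_cvgn_le (U_nd x) (U_cvg x) k.+1).
  rewrite /U /series /= big_nat_recr //= ltr_wpDl ?divr_gt0 ?exprn_gt0 //.
  exact: sumr_ge0.
have avgU : (fun M => avg (U ^~ M) x) @ \oo --> avg u x.
  apply: cvgM; last exact: cvg_cst.
  apply: cvg_big => [|y _]; first exact: add_continuous.
  by apply: cvgM; [exact: cvg_cst|exact: U_cvg].
rewrite -(cvg_lim _ avgU) //; apply: limr_le; first by apply/cvg_ex; exists (avg u x).
apply: nearW => M; rewrite /U /series /= avg_sum.
apply: (@le_trans _ _ (s * U x M.+1)); last first.
  by rewrite ler_pM2l // (nondecreasing_cvgn_le (U_nd x) (U_cvg x)).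
rewrite /U /series /= big_nat_recl // mulrDr; apply: ler_wpDl.
  exact: mulr_ge0 (ltW s0) (term_ge0 0%N x).
rewrite mulr_sumr; apply: ler_sum => n _.
under eq_fun => y do rewrite mulrC.
by rewrite avgZ -transition_nS exprS invfM mulrCA mulVKf ?gt_eqF // mulrC.
Qed.

(** Conductances: reversibility of the walk is their symmetry. *)
Definition cond x y : R := (adj x y)%:R * (lambda^-1 ^+ (dist o x) * weight x y).

Definition mass x : R := lambda^-1 ^+ (dist o x) * total_weight x.

Lemma cond_ge0 x y : 0 <= cond x y.
Proof.
rewrite /cond mulr_ge0 // mulr_ge0 ?exprn_ge0 ?invr_ge0 ?(ltW lambda_gt0) //.
exact/ltW/weight_gt0.
Qed.

Lemma mass_gt0 x : 0 < mass x.
Proof. by rewrite mulr_gt0 ?exprn_gt0 ?invr_gt0 ?total_weight_gt0. Qed.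

Lemma cond_sym x y : cond x y = cond y x.
Proof.
rewrite /cond adj_sym; case: (boolP (adj y x)) => [yx|_]; last by rewrite !mul0r.
have d1 := dist_adj G_connected o yx; rewrite adj_sym in yx.
have d2 := dist_adj G_connected o yx; rewrite !mul1r /weight /closer.
have [xy|yx'|->] := ltngtP (dist o x) (dist o y).
- have -> : ((dist o y).+1 == (dist o x)) = false by lia.
  have -> : (dist o y) = (dist o x).+1 by lia.
  by rewrite eqxx mulr1 exprSr mulfVK ?gt_eqF.
- have -> : ((dist o x).+1 == (dist o y)) = false by lia.
  have -> : (dist o x) = (dist o y).+1 by lia.
  by rewrite eqxx mulr1 exprSr mulfVK ?gt_eqF.
- by rewrite eqn_leq ltnn.
Qed.

Lemma sum_adj (B : {fset G}) x f :
  \sum_(y <- B) (adj x y)%:R * f y = \sum_(y <- nb x | y \in B) f y.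
Proof.
rewrite sum_fsetC [RHS]big_mkcond /=; apply: eq_bigr => y _.
by rewrite (mem_neighbors G_regular); case: (adj x y); rewrite ?mul1r ?mul0r.
Qed.

Lemma sum_condE (B : {fset G}) x g : \sum_(y <- B) cond x y * g y =
  lambda^-1 ^+ (dist o x) * \sum_(y <- nb x | y \in B) weight x y * g y.
Proof.
by rewrite mulr_sumr -sum_adj; apply: eq_bigr => y _; rewrite /cond -!mulrA.
Qed.

Lemma massE x g :
  mass x * avg g x = lambda^-1 ^+ (dist o x) * \sum_(y <- nb x) weight x y * g y.
Proof. by rewrite /mass /avg -mulrA [total_weight x * _]mulrC divfK ?gt_eqF ?total_weight_gt0. Qed.

Lemma sum_cond_le (B : {fset G}) x g : (forall y, 0 <= g y) ->
  \sum_(y <- B) cond x y * g y <= mass x * avg g x.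
Proof.
move=> g0; rewrite sum_condE massE ler_wpM2l ?exprn_ge0 ?invr_ge0 ?(ltW lambda_gt0) //.
rewrite big_mkcond /=; apply: ler_sum => y _; case: ifP => // _.
exact: mulr_ge0 (ltW (weight_gt0 _ _)) (g0 y).
Qed.

(** The arithmetic-geometric inequality, applied to
    [f x * f y = (u x * u y) * (f x / u x) * (f y / u y)], replaces the form
    by a sum in which [y] only occurs through [cond x y * u y]. *)
Lemma form_le_supersolution (B : {fset G}) f (u : G -> R) (s : R) :
  (forall x, 0 < u x) -> (forall x, avg u x <= s * u x) ->
  \sum_(x <- B) \sum_(y <- B) cond x y * (f x * f y) <=
  s * \sum_(x <- B) mass x * f x ^+ 2.
Proof.
move=> u0 us.
pose h x y := cond x y * (f x ^+ 2 / u x * u y).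
have amgm x y : cond x y * (f x * f y) <= (h x y + h y x) / 2.
  rewrite /h -(cond_sym x y) -mulrDr -mulrA ler_wpM2l ?cond_ge0 //.
  rewrite -subr_ge0.
  have -> : (f x ^+ 2 / u x * u y + f y ^+ 2 / u y * u x) / 2 - f x * f y =
     (f x / u x - f y / u y) ^+ 2 * (u x * u y) / 2.
    by field; rewrite !gt_eqF.
  by apply: divr_ge0 => //; apply: mulr_ge0 (sqr_ge0 _) _; apply: mulr_ge0; exact: ltW.
apply: (@le_trans _ _ (\sum_(x <- B) \sum_(y <- B) (h x y + h y x) / 2)).
  by apply: ler_sum => x _; apply: ler_sum => y _.
have -> : \sum_(x <- B) \sum_(y <- B) (h x y + h y x) / 2 =
    \sum_(x <- B) \sum_(y <- B) h x y.
  under eq_bigr => x _ do rewrite -mulr_suml big_split.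
  by rewrite -mulr_suml big_split /= [X in _ + X]exchange_big -mulr2n -[_ *+ 2]mulr_natr mulfK ?pnatr_eq0.
rewrite mulr_sumr; apply: ler_sum => x _.
apply: (@le_trans _ _ (f x ^+ 2 / u x * (mass x * avg u x))).
  under eq_bigr => y _ do rewrite /h mulrCA.
  rewrite -mulr_sumr ler_wpM2l ?divr_ge0 ?sqr_ge0 ?(ltW (u0 _)) //.
  by apply: sum_cond_le => y; exact: ltW.
have -> : f x ^+ 2 / u x * (mass x * avg u x) =
    mass x * f x ^+ 2 * (avg u x / u x) by field; rewrite gt_eqF.
rewrite [leRHS]mulrC ler_wpM2l ?(ler_pdivrMr _ _ (u0 x)) //.
exact: mulr_ge0 (ltW (mass_gt0 x)) (sqr_ge0 _).
Qed.

(** The half of the Rayleigh principle that bounds the spectral radius from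
    below by means of test functions. *)
Lemma form_le_spectral_radius (r : R) (B : {fset G}) f : 0 <= r ->
  (spectral_radius o lambda <= r%:E)%E ->
  \sum_(x <- B) \sum_(y <- B) cond x y * (f x * f y) <=
  r * \sum_(x <- B) mass x * f x ^+ 2.
Proof.
move=> r0 rr; set Q := (X in X <= _); set A := (X in _ <= _ * X).
have A0 : 0 <= A by apply: sumr_ge0 => x _; rewrite mulr_ge0 ?sqr_ge0 ?(ltW (mass_gt0 _)).
rewrite leNgt; apply/negP => QA.
pose e := (Q - r * A) / (A + 1).
have e0 : 0 < e by rewrite divr_gt0 ?subr_gt0 // ltr_wpDl.
have [||u [u0 us]] := @supersolution (r + e / 2) (r + e).
- apply/andP; split; lra.
- by rewrite (le_lt_trans rr) // lte_fin; lra.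
have := form_le_supersolution B f u0 us; rewrite -/Q -/A => QA'.
have : e * (A + 1) = Q - r * A by rewrite /e mulfVK // gt_eqF // ltr_wpDl.
nra.
Qed.

(** * The radial ground state *)

Variable a : R.
Hypothesis a_gt0 : 0 < a.
Hypothesis a_lt1 : a < 1.
Hypothesis lambdaE : lambda = a ^+ 2 * (d%:R - 1).

Definition tree_radius : R := 2 * a / (1 + a ^+ 2).

Local Notation rho := tree_radius.

Definition slope : R := (1 - a ^+ 2) / (1 + a ^+ 2).

(** The positive radial eigenfunction of the walk on the regular tree at the
    top of its spectrum.  The linear factor comes from [a] being a double
    root of the characteristic equation of [ground_rec], and [slope] is
    determined by the eigenvalue equation at the root of the tree. *)
Definition ground n : R := a ^+ n * (1 + slope * n%:R).

Lemma a2_gt0 : 0 < a ^+ 2.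
Proof. by rewrite exprn_gt0. Qed.

Lemma degree_ge1 : 1 <= d%:R - 1 :> R.
Proof. by rewrite lerBrDr -[1 + 1]/(2%:R) ler_nat. Qed.

Lemma slope_gt0 : 0 < slope.
Proof. by rewrite divr_gt0 ?subr_gt0 ?expr_lt1 ?(ltW a_gt0) // ltr_wpDr ?(ltW a2_gt0). Qed.

Lemma slope_le1 : slope <= 1.
Proof.
have a2 := a2_gt0.
by rewrite /slope ler_pdivrMr ?mul1r; lra.
Qed.

Lemma tree_radius_gt0 : 0 < rho.
Proof. by rewrite /tree_radius divr_gt0 ?mulr_gt0 // ltr_wpDr ?(ltW a2_gt0). Qed.

Lemma tree_radiusE : rho = a * (1 + slope).
Proof. by rewrite /tree_radius /slope; field; rewrite gt_eqF // ltr_wpDr ?(ltW a2_gt0). Qed.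

Lemma tree_radius_lt1 : rho < 1.
Proof.
rewrite /tree_radius ltr_pdivrMr ?mul1r; last by rewrite ltr_wpDr ?(ltW a2_gt0).
by rewrite -subr_gt0 (_ : _ - _ = (1 - a) ^+ 2); [rewrite exprn_gt0 ?subr_gt0|ring].
Qed.

Lemma ground0 : ground 0 = 1.
Proof. by rewrite /ground expr0 mulr0 addr0 mulr1. Qed.

Lemma ground_gt0 n : 0 < ground n.
Proof.
rewrite /ground mulr_gt0 ?exprn_gt0 // ltr_wpDr // mulr_ge0 //.
exact: ltW slope_gt0.
Qed.

Lemma ground_le n : ground n <= a ^+ n * n.+1%:R.
Proof.
rewrite /ground ler_wpM2l ?exprn_ge0 ?(ltW a_gt0) // -natr1 addrC lerD2r.
by rewrite ler_piMl ?slope_le1.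
Qed.

Lemma groundS_le n : ground n.+1 <= rho * ground n.
Proof.
rewrite tree_radiusE /ground exprS -mulrA -[leRHS]mulrA ler_pM2l //.
rewrite mulrCA ler_pM2l ?exprn_gt0 // -natr1.
have s0 := slope_gt0; have n0 := ler0n R n.
have : 0 <= slope ^+ 2 * n%:R by rewrite mulr_ge0 // exprn_ge0 // ltW.
by rewrite expr2; nra.
Qed.

Lemma groundS_ge n : a * ground n <= ground n.+1.
Proof.
rewrite /ground exprS -[leRHS]mulrA ler_pM2l //.
rewrite ler_wpM2l ?exprn_ge0 ?(ltW a_gt0) // lerD2l.
by rewrite ler_wpM2l ?(ltW slope_gt0) // ler_nat.
Qed.

Lemma groundS_le1 n : ground n.+1 <= ground n.
Proof.
apply: le_trans (groundS_le n) _; rewrite ler_piMl ?(ltW (ground_gt0 n)) //.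
exact: ltW tree_radius_lt1.
Qed.

Lemma ground_rec n : (d%:R - 1) * ground n.+2 + lambda * ground n =
  rho * (d%:R - 1 + lambda) * ground n.+1.
Proof.
rewrite lambdaE /tree_radius /ground /slope !exprS -!natr1; field.
by rewrite -expr2 gt_eqF // ltr_wpDr // ltW ?a2_gt0.
Qed.

Lemma ground1 : ground 1 = rho.
Proof. by rewrite /ground tree_radiusE expr1 mulr1. Qed.

(** What the neighbour [y] contributes to the excess of the average of the
    ground state over [rho] times its value, compared with what a neighbour
    one level up would contribute.  The ground state decreases, so that the
    difference is never negative. *)
Definition gain x y : R :=
  weight x y * (ground (dist o y) - rho * ground (dist o x)) +
  (rho * ground (dist o x) - ground (dist o x).+1).

Lemma gain_up x y : dist o y = (dist o x).+1 -> gain x y = 0.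
Proof.
move=> xy; rewrite /gain /weight /closer xy (_ : _ == _ = false); last by lia.
ring.
Qed.

(** A lower bound for the gain, relative to the ground state at [x], at a
    neighbour that is not one level up. *)
Definition kappa : R := Num.min 1 lambda * (1 - rho).

Lemma kappa_gt0 : 0 < kappa.
Proof. by rewrite mulr_gt0 ?lt_min ?ltr01 ?lambda_gt0 // subr_gt0 tree_radius_lt1. Qed.

Lemma gain_ge x y : adj x y -> (dist o y <= dist o x)%N ->
  kappa * ground (dist o x) <= gain x y.
Proof.
rewrite adj_sym => /(dist_adj G_connected o) xy yx.
have le1 := groundS_le (dist o x); have g0 := ground_gt0 (dist o x).
rewrite /gain /weight /closer /kappa; case: eqVneq => [e|ne].
  have := groundS_le1 (dist o y); rewrite e => g1.
  have m : Num.min 1 lambda * ((1 - rho) * ground (dist o x)) <=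
      lambda * ((1 - rho) * ground (dist o x)).
    by rewrite ler_wpM2r ?ge_min ?lexx ?orbT // mulr_ge0 ?ltW // subr_gt0 tree_radius_lt1.
  have m' : lambda * ((1 - rho) * ground (dist o x)) <=
      lambda * (ground (dist o y) - rho * ground (dist o x)).
    by rewrite ler_wpM2l ?(ltW lambda_gt0) //; lra.
  by rewrite -mulrA; lra.
have -> : dist o y = dist o x by lia.
have m : Num.min 1 lambda * ((1 - rho) * ground (dist o x)) <=
    1 * ((1 - rho) * ground (dist o x)).
  by rewrite ler_wpM2r ?ge_min ?lexx // mulr_ge0 ?ltW // subr_gt0 tree_radius_lt1.
by rewrite -mulrA; lra.
Qed.

Lemma gain_ge0 x y : adj x y -> 0 <= gain x y.
Proof.
move=> xy; have [yx|yx] := leqP (dist o y) (dist o x).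
  apply: le_trans (gain_ge xy yx).
  exact: mulr_ge0 (ltW kappa_gt0) (ltW (ground_gt0 _)).
rewrite gain_up //; have := dist_adj G_connected o xy; lia.
Qed.

Local Notation phi := (fun x => ground (dist o x)).

Lemma avg_excess x : total_weight x * (avg phi x - rho * phi x) =
  \sum_(y <- nb x) weight x y * (phi y - rho * phi x).
Proof.
rewrite mulrBr /avg mulrC divfK ?gt_eqF ?total_weight_gt0 //.
rewrite /total_weight mulr_suml -sumrB.
by apply: eq_bigr => y _; rewrite -mulrBr.
Qed.

Lemma avg_ground_root : avg phi o = rho * phi o.
Proof.
apply/eqP; rewrite -subr_eq0 -(mulrI_eq0 _ (mulfI (lt0r_neq0 (total_weight_gt0 o)))).
rewrite avg_excess; apply/eqP; apply: big1_seq => y /andP[_].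
rewrite (mem_neighbors G_regular) => oy.
have d0 := dist_root G_connected o.
have -> : dist o y = 1%N.
  have := dist_adj G_connected o oy; rewrite d0.
  case E : (dist o y) => [|n]; last by lia.
  by rewrite (dist_eq0 G_connected E) adj_irrefl in oy.
by rewrite d0 ground0 ground1 mulr1 subrr mulr0.
Qed.

(** With the other neighbours all one level up, as in the tree, both sides
    vanish by [ground_rec]; here the closer neighbour [z] plays the role of
    the parent. *)
Lemma avg_ground x z : adj x z -> closer o x z ->
  total_weight x * (avg phi x - rho * phi x) = \sum_(y <- nb x | y != z) gain x y.
Proof.
move=> xz cz; rewrite avg_excess.
set E := rho * phi x - ground (dist o x).+1.
have zx := xz; rewrite -(mem_neighbors G_regular) in zx.
have : \sum_(y <- nb x) weight x y * (phi y - rho * phi x) + E *+ d =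
    \sum_(y <- nb x) gain x y.
  by rewrite -(sum_nb_const x E) -big_split.
rewrite [in RHS](bigD1_seq z) ?fset_uniq //=.
suff -> : gain x z = E *+ d by rewrite [RHS]addrC => /addIr.
rewrite /gain -/E /weight cz; move/eqP: cz => cz.
have := ground_rec (dist o z); rewrite /E -cz -mulr_natl.
set g1 := ground _.+2; set g2 := ground _.+1; set g3 := ground _; lra.
Qed.

Lemma avg_ground_ge x : rho * phi x <= avg phi x.
Proof.
have [->|xo] := eqVneq x o; first by rewrite avg_ground_root.
have [z xz cz] := closer_adj G_connected xo.
rewrite -subr_ge0 -(pmulr_rge0 _ (total_weight_gt0 x)) (avg_ground xz cz).
rewrite big_seq_cond; apply: sumr_ge0 => y; rewrite (mem_neighbors G_regular).
by case/andP=> /gain_ge0.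
Qed.

Lemma avg_ground_merging x : merging o x ->
  kappa * phi x <= total_weight x * (avg phi x - rho * phi x).
Proof.
move=> xm; have [z xz cz] := closer_adj G_connected (merging_neq_root G_connected xm).
rewrite (avg_ground xz cz).
have [y [yz xy yx]] : exists y, [/\ y != z, adj x y & (dist o y <= dist o x)%N].
  case: xm => w1 [w2 [w12 xw1 xw2 d1 d2]].
  have [w1z|] := eqVneq w1 z; last by exists w1.
  by exists w2; split=> //; rewrite -w1z eq_sym.
apply: le_trans (gain_ge xy yx) _.
rewrite -(mem_neighbors G_regular) in xy.
rewrite (big_rem y xy) /= yz ler_wpDr // big_seq_cond; apply: sumr_ge0 => w.
by case/andP=> /mem_rem; rewrite (mem_neighbors G_regular) => /gain_ge0.
Qed.

Lemma avg_ground_tree x : ~ merging o x -> avg phi x = rho * phi x.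
Proof.
move=> xm; have [->|xo] := eqVneq x o; first exact: avg_ground_root.
have [z xz cz] := closer_adj G_connected xo.
apply/eqP; rewrite -subr_eq0 -(mulrI_eq0 _ (mulfI (lt0r_neq0 (total_weight_gt0 x)))).
rewrite (avg_ground xz cz) big_seq_cond big1 // => y /andP[].
rewrite (mem_neighbors G_regular) => xy yz; apply: gain_up.
apply/eqP; rewrite eqn_leq (dist_adj G_connected o xy) ltnNge; apply/negP => yx.
by apply: xm; exists y, z; split=> //; rewrite -(eqP cz) leqnSn.
Qed.

(** The ground state is then an exact eigenfunction, and it dominates the
    indicator of [o]. *)
Lemma spectral_radius_tree_like : (forall x, ~ merging o x) ->
  (spectral_radius o lambda <= rho%:E)%E.
Proof.
move=> om; have r0 := ltW tree_radius_gt0; apply: spectral_radius_le => // n.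
suff H x : p n x o <= rho ^+ n * phi x.
  by have := H o; rewrite (dist_root G_connected) ground0 mulr1.
elim: n x => [|n IHn] x.
  rewrite /= mul1r; case: eqVneq => [->|_]; last exact: ltW (ground_gt0 _).
  by rewrite (dist_root G_connected) ground0.
rewrite transition_nS exprSr -mulrA -(avg_ground_tree (om x)) -avgZ.
exact: avg_le.
Qed.

(** * The ground state truncated to balls *)

Definition ball n : {fset G} := fset_set [set x | (dist o x <= n)%N].

Definition sphere n : {fset G} := fset_set [set x | dist o x = n].

Lemma finite_ball n : finite_set [set x | (dist o x <= n)%N].
Proof.
elim: n => [|n IHn].
  apply: (sub_finite_set _ (finite_set1 o)) => x; rewrite /= leqn0 => /eqP.
  exact: dist_eq0.
apply: (@sub_finite_set _ _ ([set o] `|` \bigcup_(y in [set y | (dist o y <= n)%N]) neighbors y)).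
  move=> x /= xn; have [->|xo] := eqVneq x o; first by left.
  right; have [y xy /eqP cy] := closer_adj G_connected xo.
  by exists y => /=; [lia|rewrite /neighbors /= adj_sym].
rewrite finite_setU; split; first exact: finite_set1.
by apply: bigcup_finite => // y _; exact: (proj1 G_regular).
Qed.

Lemma mem_ball n x : (x \in ball n) = (dist o x <= n)%N.
Proof. by rewrite in_fset_set ?mem_setE //; exact: finite_ball. Qed.

Lemma mem_sphere n x : (x \in sphere n) = (dist o x == n).
Proof.
rewrite in_fset_set; last by apply: sub_finite_set (@finite_ball n) => y /= ->.
by apply/idP/eqP => [/set_mem|/mem_set].
Qed.

Lemma sum_ball0 f : \sum_(x <- ball 0) f x = f o.
Proof.
have -> : ball 0 = [fset o]%fset.
  apply/fsetP => x; rewrite mem_ball in_fset1 leqn0.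
  apply/eqP/eqP => [/(dist_eq0 G_connected)//|->]; exact: dist_root.
by rewrite big_seq_fset1.
Qed.

Lemma ball0 : ball 0 = sphere 0.
Proof. by apply/fsetP => x; rewrite mem_ball mem_sphere leqn0. Qed.

Lemma sum_ballS n f : \sum_(x <- ball n.+1) f x =
  \sum_(x <- ball n) f x + \sum_(x <- sphere n.+1) f x.
Proof.
rewrite (bigID (fun x => (dist o x <= n)%N)) /=.
congr (_ + _); rewrite big_fset_condE; apply: eq_fbigl => x; rewrite !inE /=.
  by rewrite !mem_ball; lia.
by rewrite mem_ball mem_sphere; lia.
Qed.

Lemma ler_sum_ball m n f : (forall x, 0 <= f x) -> (m <= n)%N ->
  \sum_(x <- ball m) f x <= \sum_(x <- ball n) f x.
Proof.
move=> f0 /subnK <-; elim: (n - m)%N => // k IHk.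
by rewrite addSn sum_ballS (le_trans IHk) // lerDl sumr_ge0.
Qed.

Lemma sum_nb_le x f (P : pred G) : (forall y, 0 <= f y) ->
  \sum_(y <- nb x | P y) f y <= \sum_(y <- nb x) f y.
Proof. by move=> f0; rewrite big_mkcond /=; apply: ler_sum => y _; case: ifP. Qed.

Lemma sum_ball_nb n f : (forall x, 0 <= f x) ->
  \sum_(x <- ball n) \sum_(y <- nb x) f y <= d%:R * \sum_(y <- ball n.+1) f y.
Proof.
move=> f0.
have -> : \sum_(x <- ball n) \sum_(y <- nb x) f y =
    \sum_(x <- ball n) \sum_(y <- ball n.+1) (adj x y)%:R * f y.
  apply: eq_big_seq => x; rewrite mem_ball => xn; rewrite sum_adj.
  rewrite [LHS]big_seq_cond [RHS]big_seq_cond; apply: eq_bigl => y.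
  rewrite (mem_neighbors G_regular) mem_ball andbT; case: (boolP (adj x y)) => //= xy.
  have := dist_adj G_connected o xy; lia.
rewrite exchange_big mulr_sumr; apply: ler_sum => y _; rewrite -mulr_suml.
rewrite ler_wpM2r //; under eq_bigr => x _ do rewrite adj_sym -[_%:R]mulr1.
by rewrite sum_adj -(sum_nb_const y 1) sum_nb_le.
Qed.

Definition energy n : R := \sum_(x <- ball n) mass x * phi x ^+ 2.

Lemma mass_ground_gt0 x : 0 < mass x * phi x ^+ 2.
Proof. by rewrite mulr_gt0 ?mass_gt0 ?exprn_gt0 ?ground_gt0. Qed.

Lemma energy_gt0 : 0 < energy 0.
Proof. by rewrite /energy sum_ball0 mass_ground_gt0. Qed.

Lemma energy_le m n : (m <= n)%N -> energy m <= energy n.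
Proof. by apply: ler_sum_ball => x; exact/ltW/mass_ground_gt0. Qed.

(** The energy of a vertex without the factor [total_weight x], which is
    bounded: a function of the level alone, easy to compare along edges. *)
Definition density x : R := lambda^-1 ^+ dist o x * phi x ^+ 2.

Lemma density_gt0 x : 0 < density x.
Proof. by rewrite mulr_gt0 ?exprn_gt0 ?invr_gt0 ?ground_gt0. Qed.

Lemma massM_density x : mass x * phi x ^+ 2 = total_weight x * density x.
Proof. by rewrite /mass /density; ring. Qed.

Definition merging_density n : R :=
  \sum_(x <- ball n) `[< merging o x >]%:R * density x.

(** Truncation loses only the edges that leave the ball, at most the energy
    of its boundary sphere; each merging vertex brings a gain. *)
Lemma form_ge n : rho * energy n.+1 + kappa * merging_density n.+1 -
    (energy n.+1 - energy n) <=
  \sum_(x <- ball n.+1) \sum_(y <- ball n.+1) cond x y * (phi x * phi y).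
Proof.
have -> : energy n.+1 - energy n =
    \sum_(x <- ball n.+1) (dist o x == n.+1)%:R * (mass x * phi x ^+ 2).
  rewrite {1}/energy sum_ballS -/(energy n) addrC addKr sum_ballS.
  rewrite [X in _ = X + _]big1_seq ?add0r; last first.
    by move=> x; rewrite mem_ball => /andP[_ xn]; rewrite (_ : _ == _ = false) ?mul0r //; lia.
  by apply: eq_big_seq => x; rewrite mem_sphere => ->; rewrite mul1r.
rewrite mulr_sumr mulr_sumr -big_split -sumrB /=.
rewrite big_seq [leRHS]big_seq; apply: ler_sum => x; rewrite mem_ball => xn.
under eq_bigr => y _ do rewrite mulrCA.
rewrite -mulr_sumr sum_condE.
pose q := \sum_(y <- nb x) weight x y * phi y.
have merge : kappa * (`[< merging o x >]%:R * density x) <=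
    phi x * (lambda^-1 ^+ dist o x * (q - total_weight x * (rho * phi x))).
  have -> : q - total_weight x * (rho * phi x) =
      total_weight x * (avg phi x - rho * phi x).
    by rewrite mulrBr [_ * avg _ _]mulrC /avg divfK // gt_eqF ?total_weight_gt0.
  have c0 : 0 < phi x * lambda^-1 ^+ dist o x.
    by rewrite mulr_gt0 ?exprn_gt0 ?invr_gt0 ?ground_gt0.
  rewrite mulrA; case: asboolP => xm.
    have -> : kappa * true%:R * density x =
        phi x * lambda^-1 ^+ dist o x * (kappa * phi x).
      by rewrite /density /=; ring.
    by rewrite [leRHS]mulrA ler_pM2l // avg_ground_merging.
  rewrite /= mulr0 mul0r [leRHS]mulrA pmulr_rge0 // pmulr_rge0 ?total_weight_gt0 //.
  by rewrite subr_ge0 avg_ground_ge.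
(* Only neighbours of vertices of the last sphere lie outside of the ball, and
   the ground state is smaller there. *)
suff boundary : q - (dist o x == n.+1)%:R * (total_weight x * phi x) <=
    \sum_(y <- nb x | y \in ball n.+1) weight x y * phi y.
  have c0 : 0 <= phi x * lambda^-1 ^+ dist o x.
    by rewrite ltW // mulr_gt0 ?exprn_gt0 ?invr_gt0 ?ground_gt0.
  have := ler_wpM2l c0 boundary; move: merge; rewrite /mass => {boundary c0}.
  move: (kappa * _) (\sum_(_ <- _ | _) _) (_ == _)%:R q.
  by move: (phi x) (lambda^-1 ^+ _) (total_weight x) => F L T M S e q; lra.
rewrite [X in _ * (X * _)]/total_weight mulr_suml mulr_sumr -sumrB.
rewrite [leRHS]big_mkcond /= big_seq [leRHS]big_seq; apply: ler_sum => y.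
rewrite (mem_neighbors G_regular) mem_ball => xy.
have := dist_adj G_connected o xy => yx.
have w0 := weight_gt0 x y; have fx0 := ground_gt0 (dist o x).
case: leqP => yn.
  by rewrite lerBlDr lerDl mulr_ge0 // mulr_ge0 // ltW.
have -> : dist o x = n.+1 by lia.
rewrite eqxx mul1r subr_le0 ler_pM2l //.
by have -> : dist o y = n.+2; [lia|exact: groundS_le1].
Qed.

(** Count the edges between the two spheres: every vertex has a neighbour one
    level down, hence at most [d - 1] neighbours one level up. *)
Lemma card_sphereS n : (0 < n)%N ->
  \sum_(x <- sphere n.+1) 1 <= (d%:R - 1) * \sum_(x <- sphere n) 1 :> R.
Proof.
move=> n0.
apply: (@le_trans _ _ (\sum_(x <- sphere n.+1) \sum_(y <- sphere n) (adj x y)%:R * 1)).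
  rewrite big_seq [leRHS]big_seq; apply: ler_sum => x; rewrite mem_sphere => /eqP xn.
  have xo : x != o by apply: contra_eq_neq xn => ->; rewrite dist_root.
  have [y xy /eqP cy] := closer_adj G_connected xo.
  have yn : y \in sphere n by rewrite mem_sphere; apply/eqP; lia.
  by rewrite (big_rem y yn) /= xy mulr1 lerDl sumr_ge0 // => z _; rewrite mulr1.
rewrite exchange_big mulr_sumr big_seq [leRHS]big_seq; apply: ler_sum => y.
rewrite mem_sphere => /eqP yn; rewrite mulr1.
have yo : y != o by apply: contra_eq_neq yn => ->; rewrite dist_root //; lia.
have [z yz /eqP cz] := closer_adj G_connected yo.
under eq_bigr => x _ do rewrite adj_sym.
rewrite sum_adj lerBrDr -(sum_nb_const y 1).
rewrite -(mem_neighbors G_regular) in yz.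
rewrite (big_rem z yz) [leRHS](big_rem z yz) /= mem_sphere.
have -> : (dist o z == n.+1) = false by lia.
rewrite add0r [leLHS]addrC lerD2l big_mkcond.
by apply: ler_sum => x _; case: ifP.
Qed.

Lemma card_sphere n : \sum_(x <- sphere n) 1 <= 2 * (d%:R - 1) ^+ n :> R.
Proof.
have b1 := degree_ge1.
case: n => [|n].
  by rewrite -ball0 sum_ball0 expr0 mulr1 ler1n.
elim: n => [|n IHn]; last first.
  apply: le_trans (card_sphereS _) _ => //; rewrite exprS mulrCA ler_pM2l //; lra.
apply: (@le_trans _ _ d%:R); last by rewrite expr1; lra.
apply: (@le_trans _ _ (\sum_(x <- sphere 1) \sum_(y <- ball 0) (adj y x)%:R * 1)).
  rewrite big_seq [leRHS]big_seq; apply: ler_sum => x; rewrite mem_sphere => /eqP xn.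
  rewrite sum_ball0 mulr1.
  have xo : x != o by apply: contra_eq_neq xn => ->; rewrite dist_root.
  have [y xy /eqP cy] := closer_adj G_connected xo.
  have := xy; rewrite adj_sym (dist_eq0 G_connected (_ : dist o y = 0%N)) => [->//|].
  by lia.
rewrite exchange_big sum_ball0 sum_adj -(sum_nb_const o 1).
by apply: sum_nb_le.
Qed.

(** On level [n] the energy density is at most of order
    [n ^+ 2 / (d - 1) ^+ n], which balances the number of vertices. *)
Lemma energy_poly : exists C, forall n, energy n <= C * n.+1%:R ^+ 3.
Proof.
pose C : R := 2 * (d%:R * (1 + lambda)).
have b0 : 0 < d%:R - 1 :> R by apply: lt_le_trans degree_ge1.
have C0 : 0 <= C by rewrite !mulr_ge0 // addr_ge0 // ltW.
have sph n : \sum_(x <- sphere n) mass x * phi x ^+ 2 <= C * n.+1%:R ^+ 2.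
  apply: (@le_trans _ _ (\sum_(x <- sphere n)
      d%:R * (1 + lambda) * ((d%:R - 1)^-1 ^+ n * n.+1%:R ^+ 2) * 1)).
    rewrite big_seq [leRHS]big_seq; apply: ler_sum => x; rewrite mem_sphere => /eqP xn.
    rewrite mulr1 massM_density; apply: ler_pM.
    - exact/ltW/total_weight_gt0.
    - exact/ltW/density_gt0.
    - exact: total_weight_le.
    rewrite /density xn; have := ground_le n => gn.
    have -> : (d%:R - 1)^-1 ^+ n = lambda^-1 ^+ n * (a ^+ n) ^+ 2.
      rewrite -exprM mulnC exprM -exprMn lambdaE; congr (_ ^+ _); field.
      by rewrite gt_eqF //= gt_eqF.
    rewrite -mulrA -exprMn ler_wpM2l ?exprn_ge0 ?invr_ge0 ?(ltW lambda_gt0) //.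
    by rewrite lerXn2r ?nnegrE ?(ltW (ground_gt0 _)) // mulr_ge0 ?exprn_ge0 ?(ltW a_gt0).
  rewrite -mulr_sumr.
  apply: le_trans (ler_wpM2l _ (card_sphere n)) _.
    by rewrite !mulr_ge0 ?exprn_ge0 ?invr_ge0 ?(ltW b0) ?addr_ge0 ?(ltW lambda_gt0).
  rewrite exprVn le_eqVlt; apply/orP; left; apply/eqP; rewrite /C; field.
  by rewrite expf_neq0 // gt_eqF.
exists C; elim=> [|n IHn].
  by have := sph 0%N; rewrite -ball0 !expr1n.
rewrite /energy sum_ballS; apply: le_trans (lerD IHn (sph n.+1)) _.
rewrite -mulrDr ler_wpM2l // -[n.+2%:R]natr1 -[n.+1%:R]natr1.
have n0 := ler0n R n; nra.
Qed.

Lemma merging_density_le m n : (m <= n)%N ->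
  merging_density m <= merging_density n.
Proof.
by apply: ler_sum_ball => x; rewrite mulr_ge0 // ltW ?density_gt0.
Qed.

Lemma density_adj : exists2 K, 0 < K & forall x y, adj x y ->
  density x <= K * density y.
Proof.
have b1 := degree_ge1; have l1 : 0 < lambda^-1 by rewrite invr_gt0.
exists (d%:R - 1 + 1 + lambda^-1) => [|x y xy]; first lra.
have d0 := ltW (density_gt0 y).
have up := dist_adj G_connected o xy; rewrite adj_sym in xy.
have down := dist_adj G_connected o xy.
rewrite !mulrDl mul1r.
have [lt|lt|e] := ltngtP (dist o x) (dist o y).
- have yE : dist o y = (dist o x).+1 by lia.
  suff : density x <= (d%:R - 1) * density y.
    have := mulr_ge0 (ltW l1) d0; lra.
  have -> : (d%:R - 1) = lambda / a ^+ 2.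
    by rewrite lambdaE mulrAC mulfV ?mul1r // gt_eqF ?a2_gt0.
  rewrite /density yE [lambda^-1 ^+ _.+1]exprS.
  have -> : lambda / a ^+ 2 * (lambda^-1 * lambda^-1 ^+ dist o x *
      ground (dist o x).+1 ^+ 2) =
      lambda^-1 ^+ dist o x * (ground (dist o x).+1 / a) ^+ 2.
    by rewrite expr_div_n; field; rewrite !gt_eqF.
  rewrite ler_pM2l ?exprn_gt0 // lerXn2r ?nnegrE ?divr_ge0 ?(ltW (ground_gt0 _)) ?(ltW a_gt0) //.
  by rewrite ler_pdivlMr // mulrC groundS_ge.
- have xE : dist o x = (dist o y).+1 by lia.
  suff : density x <= lambda^-1 * density y.
    have := mulr_ge0 (le_trans ler01 b1) d0; lra.
  rewrite /density xE exprS -mulrA ler_pM2l // ler_pM2l ?exprn_gt0 //.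
  by rewrite lerXn2r ?nnegrE ?(ltW (ground_gt0 _)) // groundS_le1.
- rewrite {1}/density e -/(density y).
  have := mulr_ge0 (ltW l1) d0; have := mulr_ge0 (le_trans ler01 b1) d0; lra.
Qed.

(** Moving one step away from the merging vertices costs at most a constant
    factor, as the density varies by a bounded factor along edges and degrees
    are bounded. *)
Lemma near_merging_density k : exists2 C, 0 < C & forall n,
  \sum_(x <- ball n) `[< near_merging o k x >]%:R * density x <=
  C * merging_density (n + k).
Proof.
have [K K0 densityK] := density_adj.
elim: k => [|k [C C0 IHk]].
  exists 1 => // n; rewrite mul1r addn0; apply: ler_sum => x _.
  rewrite ler_wpM2r ?(ltW (density_gt0 x)) // ler_nat.
  by case: asboolP => // /near_merging0 xm; case: asboolP.
have C1 : 0 < C * (1 + K * d%:R).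
  by rewrite mulr_gt0 // ltr_pwDl // mulr_ge0 // ltW.
exists (C * (1 + K * d%:R)) => // n.
pose h x : R := `[< near_merging o k x >]%:R * density x.
have h0 x : 0 <= h x by rewrite mulr_ge0 // ltW ?density_gt0.
apply: (@le_trans _ _ (\sum_(x <- ball n) h x +
    K * \sum_(x <- ball n) \sum_(y <- nb x) h y)).
  rewrite mulr_sumr -big_split; apply: ler_sum => x _ /=.
  have S0 : 0 <= K * \sum_(y <- nb x) h y.
    by rewrite mulr_ge0 ?(ltW K0) // sumr_ge0.
  case: asboolP => [|_]; last by rewrite mul0r addr_ge0.
  case/near_mergingS => [kx|[y xy ky]].
    by rewrite {1}/h; case: asboolP => // _; rewrite lerDl.
  rewrite mul1r ler_wpDl // (le_trans (densityK _ _ xy)) // ler_pM2l //.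
  rewrite -(mem_neighbors G_regular) in xy; rewrite (big_rem y xy) /=.
  rewrite {1}/h; case: asboolP => // _; rewrite mul1r lerDl; exact: sumr_ge0.
have := sum_ball_nb n h0; rewrite -(ler_pM2l K0) => le1.
have le2 := IHk n.+1; have le3 := IHk n.
have le4 : C * merging_density (n + k) <= C * merging_density (n.+1 + k).
  by rewrite ler_pM2l // merging_density_le // leq_add2r.
have le5 : K * d%:R * (\sum_(y <- ball n.+1) h y) <= K * d%:R * (C * merging_density (n.+1 + k)).
  by rewrite ler_wpM2l // mulr_ge0 // ltW.
rewrite -addSnnS; move: le1 le3 le4 le5; rewrite -/(h _).
set M := merging_density _; set s1 := \sum_(_ <- _) h _.
set s2 := \sum_(_ <- _) h _; set s3 := \sum_(_ <- _) _; set M0 := merging_density _.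
lra.
Qed.

(** * Comparison with the regular tree *)

(** Otherwise the form of the truncated ground state would force the energy
    of balls to grow exponentially with their radius. *)
Lemma spectral_radius_ge : (rho%:E <= spectral_radius o lambda)%E.
Proof.
rewrite leNgt; apply/negP => lt_rho.
have [r [r0 r_rho rr]] : exists r, [/\ 0 <= r, r < rho & (spectral_radius o lambda <= r%:E)%E].
  move: lt_rho; case: (spectral_radius o lambda) => [r|//|_].
    rewrite lte_fin => r_rho; exists (Num.max r 0).
    by rewrite le_max lexx orbT gt_max r_rho tree_radius_gt0 lee_fin le_max lexx.
  by exists 0; rewrite tree_radius_gt0 leNye.
have [A energyA] := energy_poly.
apply: (@cubic_growth _ energy 0 A (rho - r)); rewrite ?subr_gt0 ?energy_gt0 //.
move=> n; rewrite addn1.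
have := le_trans (form_ge n) (form_le_spectral_radius _ _ r0 rr).
rewrite -/(energy n.+1).
have : 0 <= kappa * merging_density n.+1.
  rewrite mulr_ge0 ?(ltW kappa_gt0) // sumr_ge0 // => x _.
  by rewrite mulr_ge0 // ltW ?density_gt0.
have := energy_le (leqnSn n); nra.
Qed.

(** The gain at merging vertices is now a fixed proportion of the energy, and
    it can only be compensated by the boundary term, again at the price of
    exponential growth. *)
Lemma spectral_radius_gt L : (forall x, near_merging o L x) ->
  (rho%:E < spectral_radius o lambda)%E.
Proof.
move=> near; rewrite ltNge; apply/negP => le_rho.
have [C C0 nearC] := near_merging_density L.
have D0 : 0 < d%:R * (1 + lambda) * C by rewrite !mulr_gt0 ?ltr0n ?(ltnW d_ge2) // addr_gt0.
pose eta := kappa / (d%:R * (1 + lambda) * C).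
have eta0 : 0 < eta by rewrite divr_gt0 ?kappa_gt0.
have [A energyA] := energy_poly.
apply: (@cubic_growth _ energy L A eta energy_gt0 eta0 energyA) => n.
have := le_trans (form_ge (n + L)) (form_le_spectral_radius _ _ (ltW tree_radius_gt0) le_rho).
rewrite -/(energy (n + L).+1) -addnS => form.
have le1 : energy n <= d%:R * (1 + lambda) * (C * merging_density (n + L.+1)).
  apply: (@le_trans _ _ (d%:R * (1 + lambda) * \sum_(x <- ball n) density x)).
    rewrite mulr_sumr; apply: ler_sum => x _; rewrite massM_density.
    by rewrite ler_wpM2r ?total_weight_le // ltW ?density_gt0.
  rewrite ler_wpM2l ?mulr_ge0 ?addr_ge0 ?(ltW lambda_gt0) //.
  apply: (@le_trans _ _ (C * merging_density (n + L))); last first.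
    by rewrite ler_pM2l // merging_density_le // leq_add2l.
  apply: le_trans (nearC n); apply: ler_sum => x _.
  by case: asboolP => [_|/(_ (near x))//]; rewrite mul1r.
have le2 : eta * energy n <= kappa * merging_density (n + L.+1).
  rewrite /eta mulrAC ler_pdivrMr // -[leRHS]mulrA ler_pM2l ?kappa_gt0 //.
  by rewrite [leRHS]mulrC -[leRHS]mulrA.
have := energy_le (leq_addr L n); lra.
Qed.

End Walk.

Theorem theorem1p2 (R : realType) (d : nat) (G : graph) (o : G) (lambda : R)
    (d_ge2 : (2 <= d)%N) (G_regular : regular G d)
    (G_infinite : infinite_graph G) (G_connected : connected_graph G)
    (lambda_gt0 : 0 < lambda) (lambda_lt : lambda < d%:R - 1) :
  ((spectral_radius (tree_root d) lambda <= spectral_radius o lambda)%E /\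
   spectral_radius (tree_root d) lambda =
     (2 * Num.sqrt ((d%:R - 1) * lambda) / (d%:R - 1 + lambda))%:E) /\
  (vertex_transitive G ->
     (spectral_radius o lambda = spectral_radius (tree_root d) lambda <->
      isomorphic G (regular_tree d))).
Proof.
pose a := Num.sqrt (lambda / (d%:R - 1)).
have b0 : 0 < d%:R - 1 :> R := lt_trans lambda_gt0 lambda_lt.
have a_gt0 : 0 < a by rewrite sqrtr_gt0 divr_gt0.
have lambdaE : lambda = a ^+ 2 * (d%:R - 1).
  by rewrite sqr_sqrtr ?divfK ?gt_eqF // divr_ge0 // ltW.
have a_lt1 : a < 1.
  by rewrite -sqrtr1 ltr_sqrt // ltr_pdivrMr // mul1r.
have ge_rho (H : graph) (x : H) : connected_graph H -> regular H d ->
    ((tree_radius a)%:E <= spectral_radius x lambda)%E.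
  by move=> Hc Hr; apply: (spectral_radius_ge _ d_ge2).
have le_rho (H : graph) (x : H) : connected_graph H -> acyclic H ->
    regular H d -> (spectral_radius x lambda <= (tree_radius a)%:E)%E.
  move=> Hc Ha Hr.
  by apply: (spectral_radius_tree_like d_ge2) => // y; apply: acyclic_not_merging.
have treeE : spectral_radius (tree_root d) lambda = (tree_radius a)%:E.
  apply/le_anti/andP; split.
    exact: le_rho (@regular_tree_connected d) (@regular_tree_acyclic d) (@regular_tree_regular d).
  exact: ge_rho (@regular_tree_connected d) (@regular_tree_regular d).
rewrite !treeE; split; [split|move=> G_transitive; split=> [radiusE|iso]].
- exact: ge_rho.
- congr (_%:E); rewrite lambdaE mulrCA -expr2 -exprMn sqrtr_sqr.
  rewrite ger0_norm; last by rewrite mulr_ge0 // ltW.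
  rewrite -[X in _ / (X + _)]mul1r -mulrDl mulrA -mulf_div divff ?mulr1 //.
  by rewrite gt_eqF.
- apply: (@isomorphic_regular_tree _ _ o) => //; apply: contrapT => G_cyclic.
  have [L near] := transitive_merging o G_transitive G_cyclic.
  suff : ((tree_radius a)%:E < spectral_radius o lambda)%E by rewrite radiusE ltxx.
  exact: (spectral_radius_gt d_ge2 _ _ _ _ _ _ near).
- apply/le_anti/andP; split; last exact: ge_rho.
  exact: le_rho (isomorphic_acyclic iso (@regular_tree_acyclic d)) _.
Qed.
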